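(* Let $0<\alpha<1$. Let $\{\mu_n\}_{n=1}^\infty$ be a sequence of probability measures on $\mathbb{R}$ with finite moments, and write $d\mu_n(x)=w_n(x)\,dx+d\mu_{n,\mathrm{sing}}(x)$. Assume $x^*\in I$ for some interval $I$ with $I\subseteq \mathrm{supp}(\mu_n)$ for all $n$, so that: (i) for all $n$, $\mu_{n,\mathrm{sing}}(I)=0$; (ii) $\sup_{n \in \mathbb{N}}\sup_{t \in I} \frac{\widetilde{K}_n(t,t)}{n}=C<\infty$; (iii) $\{\mu_n\}_{n=1}^\infty$ satisfies the $\alpha$-Nevai condition at $x^*$. Then for any bounded, compactly supported function $f:\mathbb{R}\to\mathbb{R}$ with a finite number of points of discontinuity, $$n^{\alpha-1}\operatorname{Var} \left( X_{f,\alpha,x^*}^{(n)}\right)=o(1)$$ as $n \rightarrow \infty$.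
   Context: All measures have infinite support. $w_n$ is the density of the absolutely continuous part of $\mu_n$ and $\mu_{n,\mathrm{sing}}$ its singular part with respect to Lebesgue measure. $K_n(x,y)=\sum_{j=0}^{n-1}p_j(x)p_j(y)$ is the $n$-th Christoffel-Darboux kernel of $\mu_n$ ($p_j$ the orthonormal polynomials of $\mu_n$), and $\widetilde K_n(x,y)=w_n(x)^{1/2}w_n(y)^{1/2}K_n(x,y)$. $\alpha$-Nevai condition at $x^*$: for any continuous compactly supported $g:\mathbb{R}\to\mathbb{R}$, $$\lim_{n\to\infty}\int\big(g(s)-g(n^\alpha(y-x^* ))\big)\frac{K_n\left(x^*+\frac{s}{n^\alpha},y\right)^2}{K_n\left(x^*+\frac{s}{n^\alpha},x^*+\frac{s}{n^\alpha}\right)}\,d\mu_n(y)=0$$ uniformly for $s$ in compact subsets of $\mathbb{R}$. The orthogonal polynomial ensemble (OPE) of size $n$ associated with $\mu_n$ is the probability measure $\frac{1}{Z_n}\prod_{i>j}(\lambda_i-\lambda_j)^2\,d\mu_n(\lambda_1)\cdots d\mu_n(\lambda_n)$ on $\mathbb{R}^n$, with $Z_n$ a normalizing constant; $X_{f,\alpha,x^*}^{(n)}=\sum_{j=1}^n f(n^\alpha(\lambda_j-x^* ))$ with $(\lambda_1,\dots,\lambda_n)$ random from it, and $\operatorname{Var}$ is the variance with respect to it.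
   Formalization: The point x* is assumed to lie in the interior of the interval I, not merely in I; if x* is an endpoint, (i) and (ii) say nothing about μ_n on one side of x*, and the claim can fail there. *)

(* Defs.v *)
From HB Require Import structures.
From mathcomp Require Import all_boot all_order all_algebra.
From mathcomp Require Import all_classical all_reals all_analysis.
From mathcomp Require Import measurable_realfun.

Set Implicit Arguments.
Unset Strict Implicit.
Unset Printing Implicit Defensive.

Import Order.TTheory GRing.Theory Num.Theory.
Import numFieldNormedType.Exports.

Local Open Scope classical_set_scope.
Local Open Scope ring_scope.

Section measures_on_the_line.
Context {R : realType}.
Implicit Types mu nu : {measure set (measurableTypeR R) -> \bar R}.

Definition measure_support mu : set R :=
  [set x | forall U : set R, open U -> U x -> (0 < mu U)%E].

Definition finite_moments mu : Prop :=
  forall k : nat, mu.-integrable setT (fun x : R => (x ^+ k)%:E).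

Definition mutually_singular mu nu : Prop :=
  exists N : set R, [/\ measurable N, mu N = 0%E & nu (~` N) = 0%E].

(* d mu = w dx + d musing; the density w is an arbitrary nonnegative
   everywhere-defined version. *)
Definition lebesgue_decomposition mu (w : R -> R)
    (musing : {measure set (measurableTypeR R) -> \bar R}) : Prop :=
  [/\ measurable_fun setT w,
      forall x, 0 <= w x,
      mutually_singular (@lebesgue_measure R) musing &
      forall A : set R, measurable A ->
        mu A = (\int[@lebesgue_measure R]_(x in A) (w x)%:E + musing A)%E].

(* The positive leading coefficients make the sequence unique. *)
Definition orthonormal_polynomials mu (p : nat -> {poly R}) : Prop :=
  [/\ forall j, size (p j) = j.+1,
      forall j, 0 < lead_coef (p j) &
      forall i j,
        (\int[mu]_x ((p i).[x] * (p j).[x])%:E = ((i == j)%:R : R)%:E)%E].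

Definition cd_kernel (p : nat -> {poly R}) (n : nat) (x y : R) : R :=
  \sum_(j < n) (p j).[x] * (p j).[y].

Definition weighted_cd_kernel (w : R -> R) (p : nat -> {poly R}) (n : nat)
    (x y : R) : R :=
  Num.sqrt (w x) * Num.sqrt (w y) * cd_kernel p n x y.

End measures_on_the_line.

Definition compactly_supported {R : realType} (f : R -> R) : Prop :=
  compact (closure [set x | f x != 0]).

(* [p n] stands for the orthonormal polynomials of [mu n]. *)
Definition nevai_condition {R : realType}
    (mu : nat -> probability (measurableTypeR R) R)
    (p : nat -> nat -> {poly R}) (alpha xstar : R) : Prop :=
  forall g : R -> R, continuous g -> compactly_supported g ->
  forall A : set R, compact A ->
  {uniform A, (fun (n : nat) (s : R) =>
     let xs := xstar + s / n%:R `^ alpha in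
     \int[mu n]_y ((g s - g (n%:R `^ alpha * (y - xstar))) *
       (cd_kernel (p n) n xs y ^+ 2 / cd_kernel (p n) n xs xs)))
   @ \oo --> (fun=> 0 : R)}.

Section power_probability.
Context {d : measure_display} {T : measurableType d} {R : realType}.

Definition cons_pair (n : nat) (x : T * n.-tuple T) : n.+1.-tuple T :=
  [tuple of x.1 :: x.2].

Lemma measurable_cons_pair n : measurable_fun setT (@cons_pair n).
Proof. exact: measurable_cons. Qed.

HB.instance Definition _ n :=
  isMeasurableFun.Build _ _ _ _ (@cons_pair n) (@measurable_cons_pair n).

Fixpoint power_probability (P : probability T R) (n : nat) :
    probability (n.-tuple T) R :=
  match n with
  | 0 => \d_([tuple] : 0.-tuple T)
  | n'.+1 => distribution (P \x power_probability P n')%E (@cons_pair n')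
  end.

End power_probability.

Section orthogonal_polynomial_ensemble.
Context {R : realType}.
Local Notation E n := (n.-tuple (measurableTypeR R)).

Definition vandermonde_sq (n : nat) (l : E n) : R :=
  \prod_(i < n) \prod_(j < n | (j < i)%N) (tnth l i - tnth l j) ^+ 2.

Lemma vandermonde_sq_ge0 n (l : E n) : 0 <= vandermonde_sq l.
Proof. by apply: prodr_ge0 => i _; apply: prodr_ge0 => j _; exact: sqr_ge0. Qed.

Lemma measurable_vandermonde_sq n : measurable_fun setT (@vandermonde_sq n).
Proof.
apply: measurable_prod => i _.
rewrite (_ : (fun l : E n => _) = fun l : E n =>
    \prod_(j <- [seq k : 'I_n <- index_enum _ | (k < i)%N])
      (tnth l i - tnth l j) ^+ 2); last first.
  by apply/funext => l; rewrite big_filter.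
apply: measurable_prod => j _.
by apply: measurable_funX; apply: measurable_funB; exact: measurable_tnth.
Qed.

Variables (mu : probability (measurableTypeR R) R) (n : nat).

Definition ope_weight (A : set (E n)) : \bar R :=
  (\int[power_probability mu n]_(l in A) (vandermonde_sq l)%:E)%E.

Let ope_weight0 : ope_weight set0 = 0%E.
Proof. exact: integral_set0. Qed.

Let ope_weight_ge0 A : (0 <= ope_weight A)%E.
Proof. by apply: integral_ge0 => l _; rewrite lee_fin vandermonde_sq_ge0. Qed.

Let ope_weight_sigma_additive : semi_sigma_additive ope_weight.
Proof.
move=> F mF tF mUF; rewrite /ope_weight ge0_integral_bigcup//=.
- apply: is_cvg_nneseries => k _ _.
  by apply: integral_ge0 => l _; rewrite lee_fin vandermonde_sq_ge0.
- apply/measurable_EFinP; apply: measurable_funTS.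
  exact: measurable_vandermonde_sq.
- by move=> l _; rewrite lee_fin vandermonde_sq_ge0.
Qed.

HB.instance Definition _ := isMeasure.Build _ _ _ ope_weight
  ope_weight0 ope_weight_ge0 ope_weight_sigma_additive.

(* [mnormalize] divides by the total mass Z_n; its second argument is a default
   used only when that mass is 0 or +oo, which infinite support and finite
   moments of [mu] exclude. *)
Definition ope : probability (E n) R :=
  mnormalize ope_weight (power_probability mu n).

End orthogonal_polynomial_ensemble.

Definition linear_statistic {R : realType} (f : R -> R) (alpha xstar : R)
    (n : nat) (l : n.-tuple (measurableTypeR R)) : R :=
  \sum_(j < n) f (n%:R `^ alpha * (tnth l j - xstar)).

Arguments linear_statistic {R} f alpha xstar n l.

(* Main.v *)
(* Let P be the orthogonal projection of L^2(mu_n) onto the polynomials of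
   degree < n.  Expanding the squared determinant det(p_j(lambda_i))^2 by Leibniz
   and integrating shows that the variance of sum_i F(lambda_i) is
   tr(P F^2 P) - tr((P F P)^2), which equals
   \int F(x) (\int (F(x) - F(y)) K_n(x,y)^2 dmu_n(y)) dmu_n(x).
   For F(x) = g(n^alpha (x - xstar)) with g continuous, the Nevai condition makes the
   inner integral o(1) K_n(x,x) uniformly on the support of F, and
   K_n(x,x) dmu_n <= C n dx on I, so the variance is o(n^(1-alpha)).
   For a general f, take g = f chi, where the continuous cutoff chi vanishes at the
   discontinuities of f and differs from 1 only delta-close to them.  The variance
   is a nonnegative quadratic form, hence Var f <= 2 Var g + 2 Var (f - g), and
   Var (f - g) <= \int (f - g)^2 K_n dmu_n = O(delta n^(1-alpha)). *)

Require Import Defs.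
From mathcomp Require Import all_boot all_order all_fingroup all_algebra.
From mathcomp Require Import all_classical all_reals all_analysis.
From mathcomp Require Import measurable_realfun ring lra.

Set Implicit Arguments.
Unset Strict Implicit.
Unset Printing Implicit Defensive.

Import Order.TTheory GRing.Theory Num.Theory.
Import numFieldNormedType.Exports.

Local Open Scope classical_set_scope.
Local Open Scope ring_scope.

(** * Integrals against a density *)

Section density.
Local Open Scope ereal_scope.
Context d (T : measurableType d) (R : realType).
Variables (mu nu : {measure set T -> \bar R}) (D : set T) (w : T -> R).
Hypotheses (mD : measurable D) (mw : measurable_fun setT w).
Hypothesis w_ge0 : forall x, (0 <= w x)%R.
Hypothesis nuE : forall A, measurable A -> A `<=` D ->
  nu A = \int[mu]_(x in A) (w x)%:E.

Import HBNNSimple.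

(** [nuE] settles indicators, linearity simple functions, and monotone convergence the rest. Asking
    [nuE] only for subsets of [D] covers a measure that is absolutely continuous on [D] alone. *)
Lemma ge0_integral_density (f : T -> \bar R) :
  measurable_fun D f -> (forall x, D x -> 0 <= f x) ->
  \int[nu]_(x in D) f x = \int[mu]_(x in D) (f x * (w x)%:E).
Proof.
move=> mf f0.
pose f_ := nnsfun_approx mD mf.
have mwD : measurable_fun D (fun x => (w x)%:E).
  by apply/measurable_EFinP; exact: measurable_funTS.
transitivity (limn (fun n => \int[nu]_(x in D) (f_ n x)%:E)).
  rewrite -monotone_convergence//.
  - apply: eq_integral => y /[!inE] yD; apply/esym/cvg_lim => //.
    by apply: cvg_nnsfun_approx=> // *; apply: f0; rewrite inE.
  - by move=> n; exact/measurable_EFinP/measurable_funTS/measurable_funP.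
  - by move=> n y _; rewrite lee_fin.
  - by move=> y _ m n mn; rewrite lee_fin; exact/lefP/nd_nnsfun_approx.
rewrite [X in limn X](_ : _ =
    (fun n => \int[mu]_(x in D) ((f_ n x)%:E * (w x)%:E))).
  rewrite -monotone_convergence//; last 3 first.
  - move=> n; apply: emeasurable_funM => //.
    exact/measurable_EFinP/measurable_funTS/measurable_funP.
  - by move=> n x _ /=; rewrite mule_ge0 ?lee_fin.
  - move=> x _ m n mn; apply: lee_wpmul2r; rewrite lee_fin//.
    exact/lefP/nd_nnsfun_approx.
  apply: eq_integral => x /[!inE] Dx /=; apply/cvg_lim => //.
  by apply: cvgeZr => //; apply: cvg_nnsfun_approx=> // y Dy; exact: f0.
apply/funext => n.
transitivity (\sum_(k \in range (f_ n))
    \int[nu]_(x in D) (k * \1_(f_ n @^-1` [set k]) x)%:E).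
  under eq_integral do rewrite fimfunE -fsumEFin//.
  rewrite ge0_integral_fsum//; last 2 first.
  - by move=> y; apply/measurable_EFinP/measurable_funM => //.
  - by move=> y x _; rewrite nnfun_muleindic_ge0.
transitivity (\sum_(k \in range (f_ n))
    \int[mu]_(x in D) ((k * \1_(f_ n @^-1` [set k]) x)%:E * (w x)%:E)); last first.
  rewrite -ge0_integral_fsum//; last 2 first.
  - move=> r; apply: emeasurable_funM => //.
    by apply/measurable_EFinP/measurable_funM => //.
  - by move=> r x _; rewrite mule_ge0 ?nnfun_muleindic_ge0 ?lee_fin.
  apply: eq_integral => x _.
  rewrite (fimfunE (f_ n)) -fsumEFin// ge0_mule_fsuml// => r.
  by rewrite nnfun_muleindic_ge0.
apply: eq_fsbigr => r _.
(* A nonnegative simple function has an empty fibre over a negative [r], so both integrals are 0. *)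
have [r0|r0] := ltP r 0%R.
  rewrite preimage_nnfun0//.
  by rewrite !integral0_eq// => x _; rewrite indic0/= mulr0 ?mul0e.
rewrite integralZl_indic_nnsfun// integral_indic//= nuE//; last exact: measurableI.
under [RHS]eq_integral => x _ do rewrite EFinM -muleA.
rewrite ge0_integralZl//; last 2 first.
- by apply: emeasurable_funM => //; exact/measurable_EFinP.
- by move=> x _; rewrite mule_ge0 ?lee_fin.
congr (_ * _); rewrite setIC integral_mkcondr.
apply: eq_integral => x _; rewrite patchE indicE.
by case: ifPn => _; rewrite ?mul1e ?mul0e.
Qed.

Lemma integral_density (f : T -> \bar R) : measurable_fun D f ->
  \int[nu]_(x in D) f x = \int[mu]_(x in D) (f x * (w x)%:E).
Proof.
move=> mf; rewrite integralE [RHS]integralE.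
rewrite !ge0_integral_density//; last 2 first.
- exact: measurable_funeneg.
- exact: measurable_funepos.
congr (_ - _); apply: eq_integral => x _.
  by rewrite !funeposE muleC maxeMr ?lee_fin// mule0 muleC.
by rewrite !funenegE muleC maxeMr ?lee_fin// mule0 muleN muleC.
Qed.

End density.

(** * Integrability together with the value of the integral *)

(** Carrying integrability along with the value lets sums, products and changes of measure be
    computed by composing lemmas, without separate finiteness goals. *)
Definition has_integral d (T : measurableType d) (R : realType)
    (mu : {measure set T -> \bar R}) (f : T -> R) (v : R) : Prop :=
  mu.-integrable setT (EFin \o f) /\ (\int[mu]_x (f x)%:E = v%:E)%E.

Section has_integral.
Context d (T : measurableType d) (R : realType).
Implicit Types (mu nu : {measure set T -> \bar R}) (f g : T -> R) (v a : R).

Lemma has_integral_Rintegral mu f : mu.-integrable setT (EFin \o f) ->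
  has_integral mu f (\int[mu]_x f x).
Proof.
by move=> intf; split=> //; rewrite fineK//; exact: integrable_fin_num.
Qed.

Lemma has_integral_unique mu f v a :
  has_integral mu f v -> has_integral mu f a -> v = a.
Proof. by move=> [_ fv] [_]; rewrite fv => -[]. Qed.

Lemma has_integral_measurable mu f v :
  has_integral mu f v -> measurable_fun setT f.
Proof. by move=> [/measurable_int /measurable_EFinP]. Qed.

Lemma has_integralZ mu f v a :
  has_integral mu f v -> has_integral mu (fun x => a * f x) (a * v).
Proof.
move=> [intf fv]; split; last first.
  by under eq_integral do rewrite EFinM; rewrite integralZl// fv EFinM.
by rewrite (_ : _ \o _ = (fun x => a%:E * (EFin \o f) x)%E)//; exact: integrableZl.
Qed.

Lemma eq_has_integral mu f g v :
  f =1 g -> has_integral mu f v -> has_integral mu g v.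
Proof. by move=> /funext ->. Qed.

Lemma has_integralD mu f g v a : has_integral mu f v -> has_integral mu g a ->
  has_integral mu (fun x => f x + g x) (v + a).
Proof.
move=> [intf fv] [intg ga]; split; last by rewrite integralD_EFin// fv ga.
by apply: (@eq_integrable _ _ _ mu _ measurableT ((EFin \o f) \+ (EFin \o g))%E) => //;
  exact: integrableD.
Qed.

Lemma has_integral_sum mu (J : Type) (s : seq J) (P : pred J)
    (f : J -> T -> R) (v : J -> R) :
  (forall j, P j -> has_integral mu (f j) (v j)) ->
  has_integral mu (fun x => \sum_(j <- s | P j) f j x) (\sum_(j <- s | P j) v j).
Proof.
move=> fv; elim: s => [|j s ihs].
  rewrite big_nil; apply: (@eq_has_integral mu (cst 0)) => [x|].
    by rewrite big_nil.
  by split; [exact: integrable0|rewrite integral0].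
rewrite big_cons; case: ifPn => Pj; last first.
  by apply: eq_has_integral ihs => x; rewrite big_cons (negbTE Pj).
by apply: eq_has_integral (has_integralD (fv j Pj) ihs) => x; rewrite big_cons Pj.
Qed.

Lemma has_integralB mu f g v a : has_integral mu f v -> has_integral mu g a ->
  has_integral mu (fun x => f x - g x) (v - a).
Proof.
move=> fv /(has_integralZ (-1)) /(has_integralD fv); rewrite mulN1r.
by apply: eq_has_integral => x; rewrite mulN1r.
Qed.

Lemma has_integral_le mu f g v a : has_integral mu f v -> has_integral mu g a ->
  (forall x, f x <= g x) -> v <= a.
Proof.
move=> [intf fv] [intg ga] fg; rewrite -lee_fin -fv -ga.
by apply: le_integral => // x _; rewrite lee_fin.
Qed.

Lemma has_integral_cst (P : probability T R) a : has_integral P (cst a) a.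
Proof.
split; last first.
  by have /= -> := integral_cst P measurableT a%:E; rewrite probability_setT mule1.
exact: finite_measure_integrable_cst.
Qed.

Lemma integrable_bounded_mul mu f g (B : R) : measurable_fun setT f ->
  (forall x, `|f x| <= B) -> mu.-integrable setT (EFin \o g) ->
  mu.-integrable setT (EFin \o (fun x => f x * g x)).
Proof.
move=> mf fB intg.
apply: (@le_integrable _ _ _ mu setT measurableT _ (fun x => B%:E * (EFin \o g) x)%E).
- apply/measurable_EFinP; apply: measurable_funM => //.
  by apply/measurable_EFinP; exact: measurable_int intg.
- move=> x _ /=; rewrite lee_fin !normrM ler_wpM2r//.
  by rewrite (le_trans (fB x))// ler_norm.
- exact: integrableZl.
Qed.

Lemma has_integral_density mu nu (w f : T -> R) v :
  measurable_fun setT w -> (forall x, 0 <= w x) -> measurable_fun setT f ->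
  (forall A, measurable A -> nu A = \int[mu]_(x in A) (w x)%:E)%E ->
  has_integral mu (fun x => f x * w x) v -> has_integral nu f v.
Proof.
move=> mw w0 mf nuE [intfw fwv].
have nuET A (mA : measurable A) (_ : A `<=` setT) := nuE A mA.
split.
  apply/integrableP; split; first exact/measurable_EFinP.
  rewrite (@ge0_integral_density _ _ _ mu nu setT w)//; last first.
    by apply: measurableT_comp => //; exact/measurable_EFinP.
  move/integrableP : intfw => [_]; apply: le_lt_trans.
  rewrite le_eqVlt; apply/orP; left; apply/eqP; apply: eq_integral => x _ /=.
  by rewrite normrM EFinM (ger0_norm (w0 x)).
rewrite (@integral_density _ _ _ mu nu setT w)//.
exact/measurable_EFinP.
Qed.

End has_integral.

(** * Product and power measures *)

Section product.
Context d1 d2 (T1 : measurableType d1) (T2 : measurableType d2) (R : realType).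

Lemma has_integral_prod (m1 : {sigma_finite_measure set T1 -> \bar R})
    (m2 : {sigma_finite_measure set T2 -> \bar R}) (f : T1 -> R) (g : T2 -> R)
    (a b : R) :
  has_integral m1 f a -> has_integral m2 g b ->
  has_integral (m1 \x m2)%E (fun z => f z.1 * g z.2) (a * b).
Proof.
move=> fa gb.
(* The iterated integral serves twice: on the absolute values it yields integrability by Tonelli, on
   [f] and [g] the value by Fubini. *)
have iterated f' g' a' b' : has_integral m1 f' a' -> has_integral m2 g' b' ->
    (\int[m1]_x \int[m2]_y (f' x * g' y)%:E = (a' * b')%:E)%E.
  move=> [if' f'a'] [ig' g'b'].
  under eq_integral => x _.
    under eq_integral do rewrite EFinM.
    rewrite integralZl// g'b' muleC.
    over.
  by rewrite integralZl// f'a' muleC EFinM.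
have intfg : (m1 \x m2)%E.-integrable setT (EFin \o (fun z => f z.1 * g z.2)).
  apply/integrable12ltyP.
    apply/measurable_EFinP; apply: measurable_funM; apply: measurableT_comp => //.
      exact: has_integral_measurable fa.
    exact: has_integral_measurable gb.
  under eq_integral do under eq_integral do rewrite /= normrM.
  rewrite (iterated (Num.norm \o f) (Num.norm \o g) _ _
    (has_integral_Rintegral (integrable_norm fa.1))
    (has_integral_Rintegral (integrable_norm gb.1))).
  exact: ltry.
split=> //.
rewrite -(integral12_prod_meas1 intfg).
exact: (iterated _ _ _ _ fa gb).
Qed.

End product.

(** Induction on [n]: [power_probability] is the image of a product measure under [cons_pair], so a
    change of variables splits off the first coordinate. *)
Lemma has_integral_power d (T : measurableType d) (R : realType)
    (P : probability T R) n (h : 'I_n -> T -> R) (v : 'I_n -> R) :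
  (forall i, has_integral P (h i) (v i)) ->
  has_integral (power_probability P n)
    (fun l => \prod_(i < n) h i (tnth l i)) (\prod_(i < n) v i).
Proof.
elim: n => [|n ihn] in h v * => hv.
  rewrite big_ord0.
  by apply: eq_has_integral (has_integral_cst _ 1) => l; rewrite big_ord0.
rewrite big_ord_recl.
have [inth hE] := has_integral_prod (hv ord0)
  (ihn (fun i => h (lift ord0 i)) _ (fun i => hv (lift ord0 i))).
have mh : measurable_fun setT
    (EFin \o (fun l : n.+1.-tuple T => \prod_(i < n.+1) h i (tnth l i))).
  apply/measurable_EFinP; apply: measurable_prod => i _.
  apply: measurableT_comp; last exact: measurable_tnth.
  exact: has_integral_measurable (hv i).
have consE (z : T * n.-tuple T) : \prod_(i < n.+1) h i (tnth (cons_pair z) i) =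
    h ord0 z.1 * \prod_(i < n) h (lift ord0 i) (tnth z.2 i).
  rewrite big_ord_recl; congr (h _ _ * _).
  by apply: eq_bigr => i _; congr (h _ _); rewrite !(tnth_nth z.1).
have intc : (P \x power_probability P n)%E.-integrable (@cons_pair _ T n @^-1` setT)
    ((EFin \o (fun l : n.+1.-tuple T => \prod_(i < n.+1) h i (tnth l i))) \o
     @cons_pair _ T n).
  rewrite preimage_setT; apply: eq_integrable inth => // z _ /=.
  by rewrite consE.
split.
  exact: (integrable_pushforward (@measurable_cons_pair _ T n) mh intc).
have := integral_pushforward (@measurable_cons_pair _ T n) mh intc measurableT.
rewrite preimage_setT => /= ->; rewrite -hE.
by apply: eq_integral => z _ /=; rewrite consE.
Qed.

(** * Squared determinants *)

Section determinants.
Variables (F : comNzRingType) (n : nat).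

(** The evaluation matrix is, up to transposition, a coefficient matrix times a Vandermonde matrix;
    since [p j] has degree [j], the former is triangular with the leading coefficients on its
    diagonal. *)
Lemma det_horner (p : nat -> {poly F}) (x : 'rV[F]_n) :
  (forall j, size (p j) = j.+1) ->
  \det (\matrix_(i < n, j < n) (p j).[x 0 i]) =
  (\prod_(j < n) lead_coef (p j)) * \det (Vandermonde n x).
Proof.
move=> szp; pose C : 'M[F]_n := \matrix_(j < n, k < n) (p j)`_k.
have -> : \matrix_(i < n, j < n) (p j).[x 0 i] = (C *m Vandermonde n x)^T.
  apply/matrixP => i j; rewrite !mxE (@horner_coef_wide _ n) ?szp//.
  by apply: eq_bigr => k _; rewrite !mxE.
rewrite det_tr det_mulmx det_trig; last first.
  by apply/is_trig_mxP => i j ij; rewrite mxE nth_default// szp.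
by congr (_ * _); apply: eq_bigr => j _; rewrite mxE lead_coefE szp.
Qed.

(** Two Leibniz expansions. When row [i] depends on the [i]-th variable alone, each summand
    separates the variables and can be integrated factor by factor. *)
Lemma prod_mul_sqr_det (A : 'M[F]_n) (h : 'I_n -> F) :
  (\prod_i h i) * (\det A) ^+ 2 =
  \sum_(s : 'S_n) \sum_(t : 'S_n)
    (-1) ^+ s * (-1) ^+ t * \prod_i (h i * (A i (s i) * A i (t i))).
Proof.
rewrite expr2 /determinant mulr_suml mulr_sumr; apply: eq_bigr => s _.
by rewrite !mulr_sumr; apply: eq_bigr => t _; rewrite !big_split/= mulrACA [LHS]mulrCA.
Qed.

Variable H : 'I_n -> 'I_n -> 'I_n -> F.

(** The part of the integrated double expansion with first permutation [s], where [H i j k] stands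
    for the integral of [h i] against [p j] times [p k]. *)
Definition signed_sum (s : 'S_n) : F :=
  \sum_(t : 'S_n) (-1) ^+ s * (-1) ^+ t * \prod_i H i (s i) (t i).

Lemma prod_delta_eq0 (s t : 'S_n) i : (forall j k, H i j k = (j == k)%:R) ->
  s i != t i -> \prod_i H i (s i) (t i) = 0.
Proof. by move=> Hi st; rewrite (bigD1 i)//= Hi (negbTE st) mul0r. Qed.

(** Orthonormality in every slot forces [t = s], and then the two signs cancel. *)
Lemma signed_sum_delta (s : 'S_n) :
  (forall i j k, H i j k = (j == k)%:R) -> signed_sum s = 1.
Proof.
move=> Hd; rewrite /signed_sum (bigD1 s)//= -expr2 sqrr_sign mul1r.
rewrite big1 => [|i _]; last by rewrite Hd eqxx.
rewrite big1 ?addr0// => t ts.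
suff [i sti] : exists i, s i != t i by rewrite (@prod_delta_eq0 s t i)// mulr0.
apply/existsP; apply: contraNT ts; rewrite negb_exists => /forallP st.
by apply/eqP/permP => i; apply/esym/eqP; have := st i; rewrite negbK.
Qed.

(** Off [a] the deltas force [t] to agree with [s], and two permutations that agree off one point
    are equal. *)
Lemma signed_sum_delta1 (s : 'S_n) a :
  (forall i j k, i != a -> H i j k = (j == k)%:R) ->
  signed_sum s = H a (s a) (s a).
Proof.
move=> Hd; rewrite /signed_sum (bigD1 s)//= -expr2 sqrr_sign mul1r.
rewrite (bigD1 a)//= big1 => [|i ia]; last by rewrite Hd// eqxx.
rewrite mulr1 big1 ?addr0// => t ts.
suff [i ia sti] : exists2 i, i != a & s i != t i.
  by rewrite (@prod_delta_eq0 s t i)// ?mulr0// => j k; rewrite Hd.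
apply/exists_inP; apply: contraNT ts; rewrite negb_exists_in => /forall_inP st.
have st' i : i != a -> s i = t i by move=> /st; rewrite negbK => /eqP.
apply/eqP/permP => i; have [->|/st'//] := eqVneq i a.
have [b sb] : exists b, s b = t a by exists ((s^-1)%g (t a)); rewrite permKV.
have [ba|/st' stb] := eqVneq b a; first by rewrite -sb ba.
by rewrite -sb (perm_inj (etrans (esym stb) sb)).
Qed.

(** The quotient [t * s^-1] fixes every point other than [a] and [b], so it is the identity or the
    transposition. *)
Lemma perm_eq_off2 (s t : 'S_n) a b : a != b ->
  (forall i, i != a -> i != b -> s i = t i) ->
  t = s \/ t = (tperm a b * s)%g.
Proof.
move=> ab st; pose u := (t * s^-1)%g.
have ufix i : i != a -> i != b -> u i = i.
  by move=> ia ib; rewrite permM -st// permK.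
have tE : t = (u * s)%g by rewrite /u -mulgA mulVg mulg1.
have ua : u a = a \/ u a = b.
  have [->|nua] := eqVneq (u a) a; first by left.
  have [->|nub] := eqVneq (u a) b; first by right.
  by have := perm_inj (ufix _ nua nub) => ua; rewrite ua eqxx in nua.
have ub : u b = a \/ u b = b.
  have [->|nua] := eqVneq (u b) a; first by left.
  have [->|nub] := eqVneq (u b) b; first by right.
  by have := perm_inj (ufix _ nua nub) => ub; rewrite ub eqxx in nub.
case: ua => ua; [left|right].
  rewrite tE (_ : u = 1%g) ?mul1g//; apply/permP => i; rewrite perm1.
  have [->//|ia] := eqVneq i a; have [->|ib] := eqVneq i b; last exact: ufix.
  by case: ub => // ub; move: ab; rewrite (perm_inj (etrans ua (esym ub))) eqxx.
rewrite tE; congr (_ * _)%g; apply/permP => i.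
have [->|ia] := eqVneq i a; first by rewrite tpermL.
have [->|ib] := eqVneq i b; last by rewrite tpermD 1?eq_sym// ufix.
rewrite tpermR; case: ub => // ub.
by move: ab; rewrite (perm_inj (etrans ua (esym ub))) eqxx.
Qed.

(* Only t = s and t = tperm a b * s contribute. *)
Lemma signed_sum_delta2 (s : 'S_n) a b : a != b ->
  (forall i j k, i != a -> i != b -> H i j k = (j == k)%:R) ->
  signed_sum s = H a (s a) (s a) * H b (s b) (s b) -
                 H a (s a) (s b) * H b (s b) (s a).
Proof.
move=> ab Hd; have ba : b != a by rewrite eq_sym.
have tss : (tperm a b * s)%g != s.
  apply: contra_neq ab => /permP/(_ a); rewrite permM tpermL => /perm_inj //.
rewrite /signed_sum (bigD1 s)//= -expr2 sqrr_sign mul1r.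
rewrite (bigD1 a)//= (bigD1 b)//= big1 => [|i /andP[ia ib]]; last first.
  by rewrite Hd// eqxx.
rewrite mulr1; congr (_ + _).
rewrite (bigD1 (tperm a b * s)%g)//= odd_permM odd_tperm ab.
rewrite signr_addb expr1 mulN1r mulrN -expr2 sqrr_sign mulN1r.
rewrite (bigD1 a)//= (bigD1 b)//= big1 => [|i /andP[ia ib]]; last first.
  by rewrite Hd// permM tpermD 1?eq_sym// eqxx.
rewrite mulr1 !permM tpermL tpermR big1 ?addr0// => t /andP[ts tts].
suff [i [ia ib sti]] : exists i, [/\ i != a, i != b & s i != t i].
  by rewrite (@prod_delta_eq0 s t i)// ?mulr0// => j k; rewrite Hd.
apply: contrapT => nst.
have [|tE|tE] := @perm_eq_off2 s t a b ab.
- move=> i ia ib; apply/eqP; apply: contrapT => /negP sti; apply: nst.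
  by exists i.
- by rewrite tE eqxx in ts.
- by rewrite tE eqxx in tts.
Qed.

End determinants.

Lemma vandermonde_sqE (R : realType) n (l : n.-tuple (measurableTypeR R)) :
  vandermonde_sq l =
  (\det (Vandermonde n (\row_(i < n) (tnth l i : R)))) ^+ 2.
Proof.
rewrite det_Vandermonde /vandermonde_sq -prodrXl.
under [RHS]eq_bigr do rewrite -prodrXl.
rewrite [RHS](exchange_big_dep xpredT)//=.
by apply: eq_bigr => i _; apply: eq_bigr => j _; rewrite !mxE.
Qed.

(** * Moments of the ensemble *)

Section ope_moments.
Context {R : realType}.
Variables (mu : probability (measurableTypeR R) R) (p : nat -> {poly R}) (n : nat).
Hypotheses (mu_moments : finite_moments mu)
  (p_orthonormal : orthonormal_polynomials mu p).
Implicit Types (F : R -> R) (q : {poly R}).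
Local Notation power := (power_probability mu n).
Local Notation E := (n.-tuple (measurableTypeR R)).

Lemma integrable_horner q : mu.-integrable setT (EFin \o (fun x : R => q.[x])).
Proof.
have : has_integral mu (fun x : R => \sum_(i < size q) q`_i * x ^+ i)
    (\sum_(i < size q) q`_i * \int[mu]_x (x ^+ i)).
  apply: has_integral_sum => i _; apply/has_integralZ/has_integral_Rintegral.
  exact: mu_moments.
by move/eq_has_integral => /(_ (fun x : R => q.[x])) [] // x; rewrite horner_coef.
Qed.

(** Matrix entry, in the orthonormal basis, of multiplication by [F] compressed to polynomials. *)
Definition gram F (j k : nat) : R :=
  \int[mu]_x (F x * ((p j).[x] * (p k).[x])).

Lemma gramC F j k : gram F j k = gram F k j.
Proof. by apply: eq_Rintegral => x _; rewrite [(p j).[x] * _]mulrC. Qed.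

Lemma integrable_mul_horner F (B : R) q : measurable_fun setT F ->
  (forall x, `|F x| <= B) ->
  mu.-integrable setT (EFin \o (fun x : R => F x * q.[x])).
Proof. by move=> mF FB; exact: integrable_bounded_mul (integrable_horner q). Qed.

Lemma has_integral_gram F (B : R) j k : measurable_fun setT F ->
  (forall x, `|F x| <= B) ->
  has_integral mu (fun x : R => F x * ((p j).[x] * (p k).[x])) (gram F j k).
Proof.
move=> mF FB; apply: has_integral_Rintegral.
have := integrable_mul_horner (p j * p k) mF FB.
by under [X in _ -> _.-integrable _ (_ \o X)]eq_fun do rewrite -hornerM.
Qed.

Lemma has_integral_orthonormal j k :
  has_integral mu (fun x : R => (p j).[x] * (p k).[x]) (j == k)%:R.
Proof.
split; last by have [_ _ ->] := p_orthonormal.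
under [X in _.-integrable _ (_ \o X)]eq_fun do rewrite -hornerM.
exact: integrable_horner.
Qed.

(** Passing from monomials to orthonormal polynomials changes the Vandermonde determinant by a
    constant factor only, and turns the one-variable integrals into Kronecker deltas. *)
Let dp (l : E) : R := \det (\matrix_(i < n, j < n) (p j).[tnth l i]).

Lemma has_integral_prod_sqr_det (h : 'I_n -> R -> R) (H : 'I_n -> 'I_n -> 'I_n -> R) :
  (forall i j k : 'I_n,
    has_integral mu (fun x : R => h i x * ((p j).[x] * (p k).[x])) (H i j k)) ->
  has_integral power (fun l => \prod_(i < n) h i (tnth l i) * dp l ^+ 2)
    (\sum_s signed_sum H s).
Proof.
move=> hH.
apply: (@eq_has_integral _ _ _ power (fun l : E => \sum_(s : 'S_n) \sum_(t : 'S_n)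
    (-1) ^+ s * (-1) ^+ t *
    \prod_i (h i (tnth l i) * ((p (s i)).[tnth l i] * (p (t i)).[tnth l i])))).
  move=> l; rewrite /dp prod_mul_sqr_det; apply: eq_bigr => s _.
  apply: eq_bigr => t _; congr (_ * _); apply: eq_bigr => i _.
  by rewrite !mxE.
apply: has_integral_sum => s _; apply: has_integral_sum => t _.
apply: has_integralZ.
exact: (has_integral_power (fun i => hH i (s i) (t i))).
Qed.

Lemma vandermonde_sq_det (l : E) :
  vandermonde_sq l = dp l ^+ 2 / (\prod_(j < n) lead_coef (p j)) ^+ 2.
Proof.
have [szp lcp _] := p_orthonormal.
have k0 : \prod_(j < n) lead_coef (p j) != 0.
  by apply/prodf_neq0 => j _; rewrite gt_eqF.
rewrite vandermonde_sqE.
have -> : dp l = \prod_(j < n) lead_coef (p j) *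
    \det (Vandermonde n (\row_(i < n) (tnth l i : R))).
  rewrite -det_horner//; congr (\det _).
  by apply/matrixP => i j; rewrite !mxE.
by rewrite exprMn mulrAC divff ?mul1r// expf_neq0.
Qed.

Lemma has_integral_sqr_det : has_integral power (fun l => dp l ^+ 2) n`!%:R.
Proof.
have := @has_integral_prod_sqr_det (fun=> cst 1) (fun _ j k => (j == k)%:R) _.
under eq_bigr do rewrite signed_sum_delta//.
rewrite sumr_const card_Sn => H.
apply: eq_has_integral (H _) => [l|_ j k]; first by rewrite big1// mul1r.
apply: eq_has_integral (has_integral_orthonormal j k) => x.
by rewrite mul1r.
Qed.

(** The leading coefficients enter the weight and its total mass alike, so they cancel and [n!]
    remains as the normalization. *)
Lemma ope_density (A : set E) : measurable A ->
  ope mu n A = (\int[power]_(l in A) (dp l ^+ 2 / n`!%:R)%:E)%E.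
Proof.
move=> mA; set K := \prod_(j < n) lead_coef (p j).
have K_neq0 : K ^+ 2 != 0.
  have [_ lcp _] := p_orthonormal.
  by rewrite expf_neq0//; apply/prodf_neq0 => j _; rewrite gt_eqF.
have fact_neq0 : n`!%:R != 0 :> R by rewrite pnatr_eq0 -lt0n fact_gt0.
have mdp : measurable_fun setT (fun l : E => (dp l ^+ 2)%:E).
  by have /has_integral_measurable/measurable_EFinP := has_integral_sqr_det.
have weightE (B : set E) : measurable B -> ope_weight mu B =
    ((K ^+ 2)^-1%:E * \int[power]_(l in B) (dp l ^+ 2)%:E)%E.
  move=> mB; rewrite -ge0_integralZl//; last 3 first.
  - exact: measurable_funTS.
  - by move=> l _; rewrite lee_fin sqr_ge0.
  - by rewrite lee_fin invr_ge0 sqr_ge0.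
  by apply: eq_integral => l _; rewrite vandermonde_sq_det mulrC EFinM.
(* The total mass is finite and nonzero, so [mnormalize] does divide by it and its default measure
   is not reached. *)
have Zn : ope_weight mu [set: E] = (n`!%:R / K ^+ 2)%:E.
  by rewrite weightE// has_integral_sqr_det.2 -EFinM mulrC.
rewrite /ope/= /mnormalize/= Zn eqe mulf_eq0 invr_eq0 (negbTE K_neq0).
rewrite (negbTE fact_neq0)/= weightE// muleAC -EFinM invf_div mulrA mulVf// mul1r.
rewrite -ge0_integralZl//; last 2 first.
- exact: measurable_funTS.
- by move=> l _; rewrite lee_fin sqr_ge0.
by apply: eq_integral => l _; rewrite mulrC EFinM.
Qed.

Lemma has_integral_ope (X : E -> R) (v : R) : measurable_fun setT X ->
  has_integral power (fun l => X l * dp l ^+ 2) (n`!%:R * v) ->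
  has_integral (ope mu n) X v.
Proof.
move=> mX Xv; apply: (has_integral_density _ _ mX ope_density).
- apply: measurable_funM => //.
  exact: has_integral_measurable has_integral_sqr_det.
- by move=> l; rewrite divr_ge0// sqr_ge0.
- have := has_integralZ n`!%:R^-1 Xv.
  rewrite mulrA mulVf ?pnatr_eq0 -?lt0n ?fact_gt0// mul1r.
  by apply: eq_has_integral => l; rewrite mulrC mulrA.
Qed.

(** For each of the [n!] permutations, reindexing both sums by [s] restores the plain double sum. *)
Lemma sum_perm (a : 'I_n -> 'I_n -> R) :
  \sum_(s : 'S_n) \sum_i \sum_(j | j != i) a (s i) (s j) =
  n`!%:R * \sum_i \sum_(j | j != i) a i j.
Proof.
rewrite mulr_natl -card_Sn -sumr_const; apply: eq_bigr => s _.
rewrite [RHS](reindex_inj (@perm_inj _ s)); apply: eq_bigr => i _.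
rewrite [RHS](reindex_inj (@perm_inj _ s)); apply: eq_bigl => j.
by rewrite (inj_eq perm_inj).
Qed.

Lemma measurable_coord F i : measurable_fun setT F ->
  measurable_fun setT (fun l : E => F (tnth l i)).
Proof. by move=> mF; apply: measurableT_comp => //; exact: measurable_tnth. Qed.

(** With [F] in slot [a] and 1 in the others, [signed_sum_delta1] leaves one diagonal Gram entry for
    each [s]; averaging over permutations gives the trace of P F P. *)
Lemma has_integral_ope_sum1 F (B : R) : measurable_fun setT F ->
  (forall x, `|F x| <= B) ->
  has_integral (ope mu n) (fun l => \sum_i F (tnth l i)) (\sum_(j < n) gram F j j).
Proof.
move=> mF FB; apply: has_integral_ope.
  by apply: measurable_sum => i; exact: measurable_coord.
have -> : n`!%:R * \sum_(j < n) gram F j j =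
    \sum_(a < n) \sum_(s : 'S_n) gram F (s a) (s a).
  rewrite exchange_big/= mulr_natl -card_Sn -sumr_const; apply: eq_bigr => s _.
  by rewrite (reindex_inj (@perm_inj _ s)).
under [X in has_integral _ X]eq_fun do rewrite mulr_suml.
apply: has_integral_sum => a _.
pose H (i j k : 'I_n) := if i == a then gram F j k else (j == k)%:R.
have <- : \sum_s signed_sum H s = \sum_(s : 'S_n) gram F (s a) (s a).
  apply: eq_bigr => s _; rewrite (@signed_sum_delta1 _ _ _ _ a) /H ?eqxx//.
  by move=> i j k /negbTE ->.
apply: eq_has_integral (@has_integral_prod_sqr_det
  (fun i => if i == a then F else cst 1) H _).
  move=> l; rewrite (bigD1 a)//= eqxx big1 ?mulr1// => i /negbTE -> //.
move=> i j k; rewrite /H; case: ifPn => _; first exact: has_integral_gram mF FB.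
by apply: eq_has_integral (has_integral_orthonormal j k) => x; rewrite mul1r.
Qed.

(** With [F] in the two slots [a] and [b], [signed_sum_delta2] leaves a principal 2 by 2 minor of
    the Gram matrix: the determinantal form of the two-point correlation. *)
Lemma has_integral_ope_sum2 F (B : R) : measurable_fun setT F ->
  (forall x, `|F x| <= B) ->
  has_integral (ope mu n)
    (fun l => \sum_i \sum_(j | j != i) F (tnth l i) * F (tnth l j))
    (\sum_(j < n) \sum_(k < n | k != j)
      (gram F j j * gram F k k - gram F j k * gram F k j)).
Proof.
move=> mF FB; apply: has_integral_ope.
  apply: measurable_sum => i; under eq_fun do rewrite -big_filter.
  by apply: measurable_sum => j; apply: measurable_funM; exact: measurable_coord.
rewrite -(sum_perm (fun j k => gram F j j * gram F k k - gram F j k * gram F k j)).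
rewrite exchange_big/=; under eq_bigr do rewrite exchange_big/=.
under [X in has_integral _ X]eq_fun do rewrite mulr_suml.
apply: has_integral_sum => a _.
under [X in has_integral _ X]eq_fun do rewrite mulr_suml.
apply: has_integral_sum => b ba.
pose H (i j k : 'I_n) :=
  if (i == a) || (i == b) then gram F j k else (j == k)%:R.
have Ha j k : H a j k = gram F j k by rewrite /H eqxx.
have Hb j k : H b j k = gram F j k by rewrite /H eqxx orbT.
have <- : \sum_s signed_sum H s = \sum_(s : 'S_n)
    (gram F (s a) (s a) * gram F (s b) (s b) - gram F (s a) (s b) * gram F (s b) (s a)).
  apply: eq_bigr => s _; rewrite (@signed_sum_delta2 _ _ _ _ a b) ?Ha ?Hb//.
    by rewrite eq_sym.
  by move=> i j k /negbTE ia /negbTE ib; rewrite /H ia ib.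
apply: eq_has_integral (@has_integral_prod_sqr_det
  (fun i => if (i == a) || (i == b) then F else cst 1) H _).
  move=> l; rewrite (bigD1 a)//= (bigD1 b)//= !eqxx orbT big1 ?mulr1//.
  by move=> i /andP[/negbTE -> /negbTE ->].
move=> i j k; rewrite /H; case: ifPn => _; first exact: has_integral_gram mF FB.
by apply: eq_has_integral (has_integral_orthonormal j k) => x; rewrite mul1r.
Qed.

(** This is tr(P F^2 P) - tr((P F P)^2) in the basis [p j]; symmetry of [gram] makes the second
    trace a sum of squares. *)
Definition kernel_variance F : R :=
  \sum_(j < n) gram (fun x => F x ^+ 2) j j -
  \sum_(j < n) \sum_(k < n) gram F j k ^+ 2.

Lemma variance_ope F (B : R) : measurable_fun setT F ->
  (forall x, `|F x| <= B) ->
  'V_(ope mu n)[fun l => \sum_i F (tnth l i)] = (kernel_variance F)%:E.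
Proof.
move=> mF FB.
have mF2 : measurable_fun setT (fun x => F x ^+ 2) by exact: measurable_funX.
have F2B x : `|F x ^+ 2| <= B ^+ 2.
  by rewrite normrX lerXn2r ?nnegrE ?(le_trans _ (FB x)).
have EX := has_integral_ope_sum1 mF FB; set c := \sum_(j < n) _ in EX.
(* The square of the statistic splits into its diagonal terms, a linear statistic of [F ^+ 2], and
   the off-diagonal ones. *)
have EX2 := has_integralD (has_integral_ope_sum1 mF2 F2B) (has_integral_ope_sum2 mF FB).
pose X (l : E) := \sum_i F (tnth l i).
have VX := has_integralD (has_integralB EX2 (has_integralZ (2 * c) EX))
  (has_integral_cst (ope mu n) (c ^+ 2)).
have /(_ _)[|_ VXE] := @eq_has_integral _ _ _ _ _ ((X \- cst c) * (X \- cst c)) _ _ VX.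
  move=> l; rewrite /= -[RHS]expr2 sqrrB; congr (_ + _).
  congr (_ - _); last by rewrite -[RHS]mulr_natl /X /=; ring.
  rewrite expr2 mulr_suml -big_split/=; apply: eq_bigr => i _.
  by rewrite mulr_sumr [RHS](bigD1 i).
rewrite /variance unlock /= unlock EX.2 /= VXE.
congr EFin; rewrite /kernel_variance.
suff -> : \sum_(j < n) \sum_(k < n | k != j)
    (gram F j j * gram F k k - gram F j k * gram F k j) =
    c ^+ 2 - \sum_(j < n) \sum_(k < n) gram F j k ^+ 2 by ring.
rewrite expr2 mulr_suml -sumrB; apply: eq_bigr => j _.
(* The minor with [k = j] is zero, so the restriction to [k != j] can be lifted. *)
rewrite mulr_sumr -sumrB [RHS](bigD1 j)//= -expr2 subrr add0r.
by apply: eq_bigr => k _; rewrite [gram F k j]gramC expr2.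
Qed.

End ope_moments.

(** * The variance in terms of the kernel *)

Section kernel_variance.
Context {R : realType}.
Variables (mu : probability (measurableTypeR R) R) (p : nat -> {poly R}) (n : nat).
Hypotheses (mu_moments : finite_moments mu)
  (p_orthonormal : orthonormal_polynomials mu p).
Implicit Types (F G : R -> R) (B : R).
Local Notation K := (cd_kernel p n).
Local Notation gram := (gram mu p).
Local Notation kernel_variance := (kernel_variance mu p n).

Lemma cd_kernel_ge0 x : 0 <= K x x.
Proof. by apply: sumr_ge0 => j _; rewrite -expr2 sqr_ge0. Qed.

(** [p 0] is a nonzero constant, and its square is one of the nonnegative summands. *)
Lemma cd_kernel_gt0 x : (0 < n)%N -> 0 < K x x.
Proof.
have [szp lcp _] := p_orthonormal.
case: n => // m _; rewrite /cd_kernel big_ord_recl -expr2.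
apply: ltr_wpDr; first by apply: sumr_ge0 => j _; rewrite -expr2 sqr_ge0.
rewrite exprn_even_gt0//= horner_coef szp big_ord1 expr0 mulr1.
by have := lcp 0%N; rewrite lead_coefE szp; exact: lt0r_neq0.
Qed.

Lemma sqr_cd_kernelE x y : K x y ^+ 2 = \sum_(j < n) \sum_(k < n)
  (p j).[x] * (p k).[x] * ((p j).[y] * (p k).[y]).
Proof.
rewrite expr2 mulr_suml; apply: eq_bigr => j _.
by rewrite mulr_sumr; apply: eq_bigr => k _; rewrite mulrACA.
Qed.

Lemma has_integral_mul_cd_kernel F B : measurable_fun setT F ->
  (forall x, `|F x| <= B) ->
  has_integral mu (fun x => F x * K x x) (\sum_(j < n) gram F j j).
Proof.
move=> mF FB; under [X in has_integral _ X]eq_fun do rewrite mulr_sumr.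
by apply: has_integral_sum => j _; exact: has_integral_gram mF FB.
Qed.

(** The reproducing property of the kernel on the diagonal, from orthonormality. *)
Lemma has_integral_sqr_cd_kernel x : has_integral mu (fun y => K x y ^+ 2) (K x x).
Proof.
under [X in has_integral _ X]eq_fun do rewrite sqr_cd_kernelE.
apply: has_integral_sum => j _.
have -> : (p j).[x] * (p j).[x] =
    \sum_(k < n) (p j).[x] * (p k).[x] * (j == k :> nat)%:R.
  rewrite (bigD1 j)//= eqxx mulr1 big1 ?addr0// => k kj.
  by rewrite (_ : (_ == _) = false) ?mulr0//; apply/negbTE; rewrite eq_sym.
apply: has_integral_sum => k _; apply: has_integralZ.
exact: has_integral_orthonormal.
Qed.

Lemma has_integral_mul_sqr_cd_kernel F B x : measurable_fun setT F ->
  (forall x, `|F x| <= B) ->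
  has_integral mu (fun y => F y * K x y ^+ 2)
    (\sum_(j < n) \sum_(k < n) (p j).[x] * (p k).[x] * gram F j k).
Proof.
move=> mF FB; apply: (@eq_has_integral _ _ _ mu (fun y => \sum_(j < n) \sum_(k < n)
    (p j).[x] * (p k).[x] * (F y * ((p j).[y] * (p k).[y])))).
  move=> y; rewrite sqr_cd_kernelE mulr_sumr; apply: eq_bigr => j _.
  by rewrite mulr_sumr; apply: eq_bigr => k _; rewrite mulrCA.
apply: has_integral_sum => j _; apply: has_integral_sum => k _.
exact/has_integralZ/has_integral_gram/FB.
Qed.

(** For measurable [S] this is the expected number of points of the ensemble in [S], by
    [has_integral_ope_sum1] applied to the indicator. *)
Definition kernel_mass (S : set R) : R := \int[mu]_x (\1_S x * K x x).

Lemma has_integral_kernel_mass S : measurable S ->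
  has_integral mu (fun x => \1_S x * K x x) (kernel_mass S).
Proof.
move=> mS.
have S1 x : `|\1_S x : R| <= 1.
  by rewrite indicE; case: (_ \in _); rewrite ?normr1 ?normr0.
exact/has_integral_Rintegral/(has_integral_mul_cd_kernel (measurable_indic mS) S1).1.
Qed.

(** The integral of the Nevai condition in the unscaled variable: [x] is xstar + s / n^alpha, and
    [F y] is g(n^alpha (y - xstar)). *)
Definition kernel_oscillation F x : R :=
  \int[mu]_y ((F x - F y) * (K x y ^+ 2 / K x x)).

(** The reproducing property evaluates the term with the constant [F x], and positivity of the
    diagonal kernel clears the quotient. *)
Lemma kernel_oscillationE F B x : measurable_fun setT F ->
  (forall x, `|F x| <= B) -> (0 < n)%N ->
  K x x * kernel_oscillation F x = F x * K x x -
    \sum_(j < n) \sum_(k < n) (p j).[x] * (p k).[x] * gram F j k.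
Proof.
move=> mF FB n0; have Kx := cd_kernel_gt0 x n0.
have := has_integralB (has_integralZ (F x) (has_integral_sqr_cd_kernel x))
  (has_integral_mul_sqr_cd_kernel x mF FB).
move=> /(has_integralZ (K x x)^-1) /(@eq_has_integral _ _ _ mu _
  (fun y => (F x - F y) * (K x y ^+ 2 / K x x))) [y|_ H]; first ring.
by rewrite /kernel_oscillation /Rintegral H /= mulrA divff ?gt_eqF// mul1r.
Qed.

(* By symmetry of the kernel, the variance is a single integral of F(x) against
   the quantity controlled by the Nevai condition. *)
Lemma has_integral_kernel_variance F B : measurable_fun setT F ->
  (forall x, `|F x| <= B) -> (0 < n)%N ->
  has_integral mu (fun x => F x * (K x x * kernel_oscillation F x))
    (kernel_variance F).
Proof.
move=> mF FB n0.
have mF2 : measurable_fun setT (fun x => F x ^+ 2) by exact: measurable_funX.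
have F2B x : `|F x ^+ 2| <= B ^+ 2.
  by rewrite normrX lerXn2r ?nnegrE ?(le_trans _ (FB x)).
apply: (@eq_has_integral _ _ _ mu (fun x => F x ^+ 2 * K x x -
    \sum_(j < n) \sum_(k < n) gram F j k * (F x * ((p j).[x] * (p k).[x])))).
  move=> x; rewrite (kernel_oscillationE x mF FB n0) mulrBr mulrA -expr2.
  congr (_ - _); rewrite mulr_sumr; apply: eq_bigr => j _.
  by rewrite mulr_sumr; apply: eq_bigr => k _; ring.
apply: has_integralB; first exact: has_integral_mul_cd_kernel mF2 F2B.
apply: has_integral_sum => j _; apply: has_integral_sum => k _.
rewrite expr2; exact/has_integralZ/has_integral_gram/FB.
Qed.

Lemma le_kernel_variance F B (S : set R) eps : measurable S ->
  measurable_fun setT F ->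
  (forall x, `|F x| <= B) -> (0 < n)%N ->
  (forall x, F x != 0 -> S x) ->
  (forall x, S x -> `|kernel_oscillation F x| <= eps) ->
  kernel_variance F <= B * eps * kernel_mass S.
Proof.
move=> mS mF FB n0 FS oscF; have Skappa := has_integral_kernel_mass mS.
apply: has_integral_le (has_integral_kernel_variance mF FB n0)
  (has_integralZ (B * eps) Skappa) _ => x.
have [Fx0|/FS Sx] := eqVneq (F x) 0; last first.
  rewrite indicE mem_set// mul1r (le_trans (ler_norm _))// !normrM.
  rewrite [`|K x x|]ger0_norm ?cd_kernel_ge0// mulrCA [leRHS]mulrC.
  by rewrite ler_wpM2l ?cd_kernel_ge0// ler_pM// oscF.
(* The right-hand side must still be nonnegative. On [S] the sign of [eps] follows from the
   oscillation bound at [x] itself; off [S] the indicator is 0. *)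
rewrite Fx0 mul0r indicE.
case: (boolP (x \in S)) => [/set_mem Sx|_]; last by rewrite mul0r mulr0.
rewrite mul1r !mulr_ge0 ?cd_kernel_ge0//.
  by rewrite (le_trans _ (FB x)).
by rewrite (le_trans _ (oscF x Sx)).
Qed.

(** Dropping the subtracted squares leaves the integral of [F ^+ 2] against the diagonal kernel, and
    [F ^+ 2] is at most [B ^+ 2] times the sum of the indicators of the cover. It serves for the
    discontinuous remainder. *)
Lemma le_kernel_variance_cover F B (J : eqType) (s : seq J) (S : J -> set R) :
  (forall d, measurable (S d)) -> measurable_fun setT F ->
  (forall x, `|F x| <= B) ->
  (forall x, F x != 0 -> exists2 d, d \in s & S d x) ->
  kernel_variance F <= B ^+ 2 * \sum_(d <- s) kernel_mass (S d).
Proof.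
move=> mS mF FB FS.
have mF2 : measurable_fun setT (fun x => F x ^+ 2) by exact: measurable_funX.
have F2B x : `|F x ^+ 2| <= B ^+ 2.
  by rewrite normrX lerXn2r ?nnegrE ?(le_trans _ (FB x)).
apply: (@le_trans _ _ (\sum_(j < n) gram (fun x => F x ^+ 2) j j)).
  rewrite gerBl; apply: sumr_ge0 => j _.
  by apply: sumr_ge0 => k _; rewrite sqr_ge0.
apply: has_integral_le (has_integral_mul_cd_kernel mF2 F2B)
  (has_integralZ (B ^+ 2) (has_integral_sum s
    (fun d (_ : xpredT d) => has_integral_kernel_mass (mS d)))) _ => x.
have SK_ge0 d : 0 <= \1_(S d) x * K x x.
  by rewrite mulr_ge0 ?cd_kernel_ge0// indicE.
have [Fx0|/FS[d ds Sdx]] := eqVneq (F x) 0.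
  by rewrite Fx0 expr0n mul0r mulr_ge0 ?sqr_ge0// sumr_ge0.
apply: ler_pM; [exact: sqr_ge0|exact: cd_kernel_ge0| |].
  by rewrite (le_trans (ler_norm _)).
rewrite (big_rem d)//= indicE mem_set// mul1r lerDl.
by apply: sumr_ge0.
Qed.

(** [variance_ope] identifies it with an actual variance. *)
Lemma kernel_variance_ge0 F B : measurable_fun setT F ->
  (forall x, `|F x| <= B) -> 0 <= kernel_variance F.
Proof.
move=> mF FB; rewrite -lee_fin.
by rewrite -(variance_ope n mu_moments p_orthonormal mF FB) variance_ge0.
Qed.

Lemma gramD F G B : measurable_fun setT F -> measurable_fun setT G ->
  (forall x, `|F x| <= B) -> (forall x, `|G x| <= B) -> forall j k,
  gram (fun x => F x + G x) j k = gram F j k + gram G j k.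
Proof.
move=> mF mG FB GB j k.
suff [_ H] : has_integral mu
    (fun x => (F x + G x) * ((p j).[x] * (p k).[x])) (gram F j k + gram G j k).
  by rewrite {1}/gram /Rintegral H.
have := has_integralD (has_integral_gram p mu_moments j k mF FB)
  (has_integral_gram p mu_moments j k mG GB).
by apply: eq_has_integral => x; rewrite mulrDl.
Qed.

Lemma gramZ F B a : measurable_fun setT F -> (forall x, `|F x| <= B) ->
  forall j k, gram (fun x => a * F x) j k = a * gram F j k.
Proof.
move=> mF FB j k.
suff [_ H] : has_integral mu
    (fun x => a * F x * ((p j).[x] * (p k).[x])) (a * gram F j k).
  by rewrite {1}/gram /Rintegral H.
have := has_integralZ a (has_integral_gram p mu_moments j k mF FB).
by apply: eq_has_integral => x; rewrite mulrA.
Qed.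

(* The variance is a nonnegative quadratic form, so it obeys the parallelogram law. *)
Lemma kernel_varianceD_le F G B : measurable_fun setT F -> measurable_fun setT G ->
  (forall x, `|F x| <= B) -> (forall x, `|G x| <= B) ->
  kernel_variance (fun x => F x + G x) <=
  2 * kernel_variance F + 2 * kernel_variance G.
Proof.
move=> mF mG FB GB; pose G' x := -1 * G x.
have mG' : measurable_fun setT G' by exact: measurable_funM.
have G'B x : `|G' x| <= B by rewrite /G' mulN1r normrN.
have FGB x : `|F x + G' x| <= B + B by rewrite (le_trans (ler_normD _ _))// lerD.
have B0 : 0 <= B by rewrite (le_trans _ (FB 0)).
have := kernel_variance_ge0 (measurable_funD mF mG') FGB.
suff -> : 2 * kernel_variance F + 2 * kernel_variance G =
    kernel_variance (fun x => F x + G x) + kernel_variance (fun x => F x + G' x).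
  by move=> ?; rewrite lerDl.
have F2B : forall x, `|F x ^+ 2| <= B ^+ 2.
  by move=> x; rewrite normrX lerXn2r ?nnegrE.
have G2B : forall x, `|G x ^+ 2| <= B ^+ 2.
  by move=> x; rewrite normrX lerXn2r ?nnegrE.
have H2 (f : R -> R) : measurable_fun setT f -> (forall x, `|f x| <= B + B) ->
    forall j, has_integral mu (fun x => f x ^+ 2 * ((p j).[x] * (p j).[x]))
      (gram (fun x => f x ^+ 2) j j).
  move=> mf fB j; apply: (@has_integral_gram _ _ p mu_moments _ ((B + B) ^+ 2)).
    exact: measurable_funX.
  by move=> x; rewrite normrX lerXn2r ?nnegrE ?addr_ge0.
have sqr_law j : gram (fun x => (F x + G x) ^+ 2) j j +
    gram (fun x => (F x + G' x) ^+ 2) j j =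
    2 * gram (fun x => F x ^+ 2) j j + 2 * gram (fun x => G x ^+ 2) j j.
  apply: has_integral_unique (has_integralD (H2 _ (measurable_funD mF mG) _ j)
      (H2 _ (measurable_funD mF mG') FGB j)) _.
    by move=> x; rewrite (le_trans (ler_normD _ _))// lerD.
  apply: eq_has_integral (has_integralD
      (has_integralZ 2 (has_integral_gram p mu_moments j j (measurable_funX 2 mF) F2B))
      (has_integralZ 2 (has_integral_gram p mu_moments j j (measurable_funX 2 mG) G2B))).
  by move=> x /=; rewrite /G'; ring.
rewrite /kernel_variance -!sumrB !mulr_sumr -!big_split/=; apply: eq_bigr => j _.
rewrite addrACA -opprD sqr_law !mulrBr addrACA -opprD; congr (_ - _).
rewrite !mulr_sumr -!big_split/=; apply: eq_bigr => k _.
by rewrite (gramD mF mG FB GB) (gramD mF mG' FB G'B) (gramZ _ mG GB); ring.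
Qed.

End kernel_variance.

(** * Kernel mass of subsets of the interval *)

Section density_bound.
Context {R : realType}.
Variables (mu : probability (measurableTypeR R) R) (p : nat -> {poly R}) (n : nat).
Variables (w : R -> R) (musing : {measure set (measurableTypeR R) -> \bar R}).
Variables (I : set R) (C : R).
Hypotheses (mu_moments : finite_moments mu)
  (mu_decomp : lebesgue_decomposition mu w musing)
  (I_interval : is_interval I) (musing_I : musing I = 0%E) (C_ge0 : 0 <= C)
  (kernel_bounded : forall t, I t -> weighted_cd_kernel w p n t t <= C).

(** Inside [I] the singular part is null, so [mu] has density [w] there, and [w] times the diagonal
    kernel is the weighted kernel, at most [C]. *)
Lemma kernel_mass_le (S : set R) (s : R) : measurable S -> S `<=` I ->
  (lebesgue_measure S <= s%:E)%E -> kernel_mass mu p n S <= C * s.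
Proof.
move=> mS SI lS; have [mw w0 _ muE] := mu_decomp.
have mI : measurable (I : set (measurableTypeR R)) by exact: is_interval_measurable.
have muS (A : set (measurableTypeR R)) : measurable A -> A `<=` S ->
    mu A = (\int[lebesgue_measure]_(x in A) (w x)%:E)%E.
  move=> mA AS; rewrite muE// (_ : musing A = 0%E) ?adde0//.
  apply/eqP; rewrite eq_le measure_ge0 andbT -musing_I.
  by apply: le_measure; rewrite ?inE//; exact: subset_trans SI.
have mK : measurable_fun setT (fun x : R => (cd_kernel p n x x)%:E).
  have B1 (x : R) : `|(fun=> 1 : R) x| <= 1 by rewrite normr1.
  have [/measurable_int + _] := has_integral_mul_cd_kernel p n mu_moments
    (@measurable_cst _ _ _ _ _ (1 : R)) B1.
  by apply: eq_measurable_fun => x _ /=; rewrite mul1r.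
rewrite -lee_fin -(has_integral_kernel_mass p n mu_moments mS).2.
rewrite [X in (X <= _)%E](_ : _ = \int[mu]_(x in S) (cd_kernel p n x x)%:E)%E; last first.
  rewrite [RHS]integral_mkcond; apply: eq_integral => x _.
  by rewrite patchE indicE; case: ifPn => _; rewrite ?mul1r ?mul0r.
rewrite (@ge0_integral_density _ (measurableTypeR R) R lebesgue_measure mu S w
  mS mw w0 muS); last 2 first.
- exact: measurable_funTS.
- by move=> x _; rewrite lee_fin cd_kernel_ge0.
apply: (@le_trans _ _ (\int[lebesgue_measure]_(x in S) (cst C%:E x))%E); last first.
  by rewrite integral_cst// EFinM; apply: lee_wpmul2l => //; rewrite lee_fin.
apply: ge0_le_integral => //.
- by move=> x _; rewrite mule_ge0// lee_fin// cd_kernel_ge0.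
- by apply: measurable_funTS; apply: emeasurable_funM => //; exact/measurable_EFinP.
- move=> x Sx; rewrite -EFinM lee_fin; apply: le_trans (kernel_bounded (SI x Sx)).
  by rewrite /weighted_cd_kernel -expr2 sqr_sqrtr// mulrC.
Qed.

End density_bound.

(** * Cutting off the discontinuities *)

Section cutoff.
Context {R : realType}.
Implicit Types (f : R -> R) (D : seq R) (delta : R).

(** A product of ramps of slope [1 / delta]: for positive [delta] it vanishes on [D] and is 1 at
    distance at least [delta] from all of [D]. *)
Definition cutoff D delta (x : R) : R :=
  \prod_(d <- D) Num.min 1 (`|x - d| / delta).

Lemma cutoff_ge0 D delta x : 0 < delta -> 0 <= cutoff D delta x.
Proof.
by move=> d0; apply: prodr_ge0 => d _; rewrite le_min ler01 divr_ge0// ltW.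
Qed.

Lemma cutoff_le1 D delta x : 0 < delta -> cutoff D delta x <= 1.
Proof.
move=> d0; apply: prodr_ile1 => d _.
by rewrite ge_min lexx /= andbT le_min ler01 divr_ge0// ltW.
Qed.

Lemma cutoff_eq0 D delta x : x \in D -> cutoff D delta x = 0.
Proof.
by move=> xD; rewrite /cutoff (big_rem x)//= subrr normr0 mul0r (min_r ler01) mul0r.
Qed.

Lemma cutoff_neq1 D delta x : 0 < delta -> cutoff D delta x != 1 ->
  exists2 d, d \in D & `|x - d| <= delta.
Proof.
move=> d0 /eqP x1; apply: contrapT => far; apply: x1.
rewrite /cutoff big_seq big1// => d dD; apply/min_l.
rewrite ler_pdivlMr// mul1r leNgt; apply/negP => /ltW close.
by apply: far; exists d.
Qed.

Lemma continuous_cutoff D delta : continuous (cutoff D delta).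
Proof.
rewrite /cutoff; elim: D => [|d D ihD].
  by under eq_fun do rewrite big_nil; exact: cst_continuous.
under eq_fun do rewrite big_cons.
move=> x.
have dist_cvg : (fun y : R => `|y - d| / delta) @ x --> `|x - d| / delta.
  apply: cvgMr_tmp; apply: cvg_norm; apply: cvgB; first exact: cvg_id.
  exact: cvg_cst.
have one_cvg : {for x, continuous (cst 1 : R -> R)} by exact: cvg_cst.
have min_cvg := @continuous_min R R (cst 1) (fun y => `|y - d| / delta) x
  one_cvg dist_cvg.
exact: (cvgM min_cvg (ihD x)).
Qed.

(** Where [f] is continuous both factors are; at the other points the cutoff tends to 0 while [f]
    stays bounded. *)
Lemma continuous_mul_cutoff f (M : R) D delta : 0 < delta ->
  (forall x, `|f x| <= M) ->
  (forall x, ~ {for x, continuous f} -> x \in D) ->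
  continuous (fun x => f x * cutoff D delta x).
Proof.
move=> d0 fM fD x.
have [fx|/fD xD] := pselect {for x, continuous f}.
  exact: (cvgM fx (@continuous_cutoff D delta x)).
have M0 : 0 <= M by rewrite (le_trans _ (fM 0)).
rewrite /prop_for /continuous_at (cutoff_eq0 delta xD) mulr0.
apply/cvgrPdist_le => e e0.
(* [M + 1] replaces [M] so that the divisor is positive even when [M] is 0. *)
have /cvgrPdist_le/(_ (e / (M + 1))) := @continuous_cutoff D delta x.
have M1 : 0 < M + 1 by rewrite ltr_wpDl.
move=> /(_ (divr_gt0 e0 M1)); rewrite (cutoff_eq0 delta xD).
apply: filterS => y; rewrite !sub0r !normrN normrM => cut.
apply: (@le_trans _ _ ((M + 1) * (e / (M + 1)))).
  by apply: ler_pM => //; rewrite (le_trans (fM y))// lerDl.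
by rewrite mulrC divfK// gt_eqF.
Qed.

(** [f] is continuous on the complement of the discontinuities, which is open, and on the finite
    exceptional set every preimage is finite. *)
Lemma measurable_finite_discontinuities f :
  finite_set [set x : R | ~ {for x, continuous f}] -> measurable_fun setT f.
Proof.
set D := [set x | _] => finD.
have mfin (A : set R) : finite_set A -> measurable A.
  by move=> finA; apply: countable_measurable => //; exact: finite_set_countable.
rewrite -(setvU D); apply/measurable_funU; [|exact: mfin|].
  by apply: measurableC; exact: mfin.
split.
- apply: open_continuous_measurable_fun.
    by rewrite openC; apply: accessible_finite_set_closed.1 => //;
      exact/hausdorff_accessible/Rhausdorff.
  by move=> x /set_mem /contrapT.
- by move=> _ Y mY; apply: mfin; apply: sub_finite_set finD => x [].
Qed.

End cutoff.

(** * Preimages of intervals under the rescaling *)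

Section band.
Context {R : realType}.
Variables (T xstar : R).
Hypothesis T_gt0 : 0 < T.

Definition band (d r : R) : set R := [set x | `|T * (x - xstar) - d| <= r].

Lemma bandE d r : band d r = `[xstar + (d - r) / T, xstar + (d + r) / T]%classic.
Proof.
apply/seteqP; split=> x; rewrite /band/= in_itv/= ler_norml.
  move=> /andP[xl xr]; apply/andP; split.
    by rewrite -lerBrDl ler_pdivrMr// mulrC; lra.
  by rewrite -lerBlDl ler_pdivlMr// mulrC; lra.
rewrite -lerBrDl ler_pdivrMr// -lerBlDl ler_pdivlMr// => /andP[xl xr].
by apply/andP; split; lra.
Qed.

Lemma measurable_band d r : measurable (band d r).
Proof. by rewrite bandE. Qed.

Lemma lebesgue_band d r : 0 <= r ->
  (lebesgue_measure (band d r) <= (2 * r / T)%:E)%E.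
Proof.
move=> r0; rewrite bandE lebesgue_measure_itv/= lte_fin.
case: ifPn => _; last by rewrite lee_fin divr_ge0 ?mulr_ge0// ltW.
rewrite -EFinB lee_fin (_ : _ - _ = 2 * r / T)//; ring.
Qed.

End band.

(** * Variance bound for one ensemble size *)

Section fixed_size.
Context {R : realType}.
Variables (mu : probability (measurableTypeR R) R) (p : nat -> {poly R}) (n : nat).
Variables (w : R -> R) (musing : {measure set (measurableTypeR R) -> \bar R}).
Variables (I : set R) (C T xstar : R).
Hypotheses (n_gt0 : (0 < n)%N) (mu_moments : finite_moments mu)
  (p_orthonormal : orthonormal_polynomials mu p)
  (mu_decomp : lebesgue_decomposition mu w musing)
  (I_interval : is_interval I) (musing_I : musing I = 0%E) (C_ge0 : 0 <= C)
  (kernel_bounded : forall t, I t -> weighted_cd_kernel w p n t t <= C)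
  (T_gt0 : 0 < T).

Local Notation rescale f := (fun x : R => f (T * (x - xstar))).

Lemma measurable_rescale (f : R -> R) : measurable_fun setT f ->
  measurable_fun setT (rescale f).
Proof.
move=> mf; apply: measurableT_comp => //; apply: measurable_funM => //.
exact: measurable_funB.
Qed.

(** The part [g] is controlled by its small oscillation on a band of width of order [a / T], the
    part [h] by the small mass of bands of width of order [delta / T] around [D]. In the application
    [T] is n^alpha and [C] is a constant times [n]. *)
Lemma kernel_variance_decomposition_le (f g h : R -> R) (M a eps delta : R)
    (D : seq R) :
  0 <= a -> 0 <= delta -> 0 <= eps ->
  measurable_fun setT g -> measurable_fun setT h ->
  (forall x, f x = g x + h x) ->
  (forall x, `|g x| <= M) -> (forall x, `|h x| <= M) ->
  (forall x, g x != 0 -> `|x| <= a) ->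
  (forall x, h x != 0 -> `|x| <= a /\ exists2 d, d \in D & `|x - d| <= delta) ->
  band T xstar 0 a `<=` I ->
  (forall x, band T xstar 0 a x ->
    `|kernel_oscillation mu p n (rescale g) x| <= eps) ->
  kernel_variance mu p n (rescale f) <=
  2 * (M * eps * (C * (2 * a / T))) +
  2 * (M ^+ 2 * ((size D)%:R * (C * (2 * delta / T)))).
Proof.
move=> a0 delta0 eps0 mg mh fE gM hM ga hD bandI osc.
have M0 : 0 <= M by rewrite (le_trans _ (gM 0)).
have mrg := measurable_rescale mg; have mrh := measurable_rescale mh.
have mb d r : measurable (band T xstar d r) by exact: measurable_band.
rewrite (_ : rescale f = fun x => rescale g x + rescale h x); last exact/funext.
apply: le_trans (kernel_varianceD_le n mu_moments p_orthonormal mrg mrh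
  (fun=> gM _) (fun=> hM _)) _.
apply: lerD; rewrite ler_pM2l//.
  apply: le_trans (le_kernel_variance mu_moments p_orthonormal (mb 0 a) mrg
    (fun=> gM _) n_gt0 _ osc) _.
    by move=> x /ga; rewrite /band/= subr0.
  apply: ler_wpM2l; first exact: mulr_ge0.
  apply: (kernel_mass_le mu_moments mu_decomp I_interval musing_I C_ge0
    kernel_bounded) => //.
  exact: lebesgue_band.
(* The bands around points of [D] may leave [I], where no kernel bound is available, so they are
   intersected with [band T xstar 0 a]. *)
apply: le_trans (@le_kernel_variance_cover _ _ _ _ mu_moments _ M _ D
  (fun d => band T xstar d delta `&` band T xstar 0 a) _ mrh _ _) _ => //.
- by move=> d; exact: measurableI.
- by move=> x /hD[xa [d dD xd]]; exists d => //; split; rewrite /band/= ?subr0.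
apply: ler_wpM2l; first exact: sqr_ge0.
rewrite mulr_natl -[leRHS]addr0 -iter_addr -count_predT -big_const_seq.
apply: ler_sum => d _.
apply: (kernel_mass_le mu_moments mu_decomp I_interval musing_I C_ge0
  kernel_bounded) => //; first exact: measurableI.
  by move=> x [_ /bandI].
apply: le_trans (lebesgue_band xstar T_gt0 d delta0).
by apply: le_measure; rewrite ?inE//;
  [exact (measurableI _ _ (mb d delta) (mb 0 a))|exact (mb d delta)].
Qed.

End fixed_size.

(** * Limits and compact supports *)

Section limits.
Context {R : realType}.

(** Writing [A] as the [alpha]-th power of A^(1/alpha), any [n] above that root works. *)
Lemma near_powR_ge (alpha A : R) : 0 < alpha -> 0 < A ->
  \forall n \near \oo, A <= n%:R `^ alpha.
Proof.
move=> alpha0 A0; near=> n.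
rewrite -[leLHS](powRr1 (ltW A0)) -[X in A `^ X](mulVf (lt0r_neq0 alpha0)) powRrM.
apply: ge0_ler_powR; rewrite ?nnegrE ?powR_ge0//; first exact: ltW.
by near: n; exact: nbhs_infty_ger.
Unshelve. all: by end_near. Qed.

Lemma uniform_cvg0 (A : set R) (F : nat -> R -> R) (e : R) : 0 < e ->
  {uniform A, F @ \oo --> (fun=> 0 : R)} ->
  \forall n \near \oo, forall s, A s -> `|F n s| < e.
Proof.
move=> e0 FA; have : nbhs ((fun=> 0 : R) : {uniform` A -> R})
    [set h : {uniform` A -> R} | forall s, A s -> ball (0 : R) e (h s)].
  apply/uniform_nbhs; exists [set xy | ball xy.1 e xy.2].
  by split; [exact: (entourage_ball _ (PosNum e0))|].
move=> /FA FAe; have : \forall n \near \oo, forall s, A s -> ball (0 : R) e (F n s).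
  exact: FAe.
apply: filterS => n Fn s As.
by have := Fn s As; rewrite -ball_normE /= sub0r normrN.
Qed.

Lemma compactly_supported_bounded (f : R -> R) : compactly_supported f ->
  exists2 a, 0 <= a & forall x, f x != 0 -> `|x| <= a.
Proof.
(* [fM] gives a bound for each radius strictly above [M]; this one is also nonnegative. *)
move=> /compact_bounded[M [_ fM]]; exists (`|M| + 1); first by rewrite addr_ge0.
move=> x fx; apply: fM; first by rewrite ltr_pwDr// ler_norm.
exact: subset_closure.
Qed.

Lemma compactly_supported_mul (f g : R -> R) : compactly_supported f ->
  compactly_supported (fun x => f x * g x).
Proof.
move=> cf; apply: subclosed_compact cf _; first exact: closed_closure.
by apply: closureS => x /=; apply: contra_neq => ->; rewrite mul0r.
Qed.

End limits.

(** * The limit of the rescaled variance *)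

Theorem theorem5p3 (R : realType) (alpha : R)
  (mu : nat -> probability (measurableTypeR R) R)
  (w : nat -> R -> R)
  (musing : nat -> {measure set (measurableTypeR R) -> \bar R})
  (p : nat -> nat -> {poly R})
  (xstar : R) (I : set R)
  (alpha_gt0 : 0 < alpha) (alpha_lt1 : alpha < 1)
  (mu_infinite : forall n, (0 < n)%N -> infinite_set (measure_support (mu n)))
  (mu_moments : forall n, (0 < n)%N -> finite_moments (mu n))
  (mu_decomp : forall n, (0 < n)%N ->
    lebesgue_decomposition (mu n) (w n) (musing n))
  (p_orthonormal : forall n, (0 < n)%N -> orthonormal_polynomials (mu n) (p n))
  (I_interval : is_interval I) (xstar_in_I : I° xstar)
  (I_support : forall n, (0 < n)%N -> I `<=` measure_support (mu n))
  (musing_I : forall n, (0 < n)%N -> musing n I = 0%E)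
  (kernel_bounded :
    (ereal_sup [set ereal_sup
       [set (weighted_cd_kernel (w n) (p n) n t t / n%:R)%:E | t in I]
     | n in [set n : nat | (0 < n)%N]] < +oo)%E)
  (nevai : nevai_condition mu p alpha xstar) :
  forall f : R -> R,
    (exists M : R, forall x, `|f x| <= M) ->
    compactly_supported f ->
    finite_set [set x : R | ~ {for x, continuous f}] ->
    ((n%:R `^ (alpha - 1))%:E
       * 'V_(ope (mu n) n) [linear_statistic f alpha xstar n])%E
      @[n --> \oo] --> 0%E.
Proof.
move=> f [M fM] f_supp finD.
have mf := measurable_finite_discontinuities finD.
have M_ge0 : 0 <= M by rewrite (le_trans _ (fM 0)).
have [C C_ge0 KC] : exists2 C : R, 0 <= C & forall n t, (0 < n)%N -> I t ->
    weighted_cd_kernel (w n) (p n) n t t <= C * n%:R.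
  move: kernel_bounded; set c := ereal_sup _ => c_fin.
  have Kc n t : (0 < n)%N -> I t ->
      ((weighted_cd_kernel (w n) (p n) n t t / n%:R)%:E <= c)%E.
    move=> n0 It.
    apply: (@le_trans _ _ (ereal_sup
        [set (weighted_cd_kernel (w n) (p n) n t t / n%:R)%:E | t in I])).
      by apply: ereal_sup_ubound; exists t.
    by apply: ereal_sup_ubound; exists n.
  (* The supremum is finite: below +oo by hypothesis, and above -oo by any of its entries. The
     absolute value makes the constant nonnegative. *)
  exists `|fine c|; first exact: normr_ge0.
  move=> n t n0 It; rewrite -ler_pdivrMr ?ltr0n//.
  apply: le_trans (ler_norm _); rewrite -lee_fin fineK ?Kc//.
  by rewrite fin_numElt c_fin andbT (lt_le_trans _ (Kc n t n0 It))// ltNyr.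
have [a a_ge0 fa] := compactly_supported_bounded f_supp.
have /finite_seqP[D DE] := finD.
have kv_ge0 n : (0 < n)%N ->
    exists2 V : R, 0 <= V &
      'V_(ope (mu n) n)[linear_statistic f alpha xstar n] = V%:E /\
      V = kernel_variance (mu n) (p n) n (fun x => f (n%:R `^ alpha * (x - xstar))).
  move=> n0; have mfn := @measurable_rescale R (n%:R `^ alpha) xstar f mf.
  eexists; last first.
    split; last reflexivity.
    exact: (variance_ope n (mu_moments n n0) (p_orthonormal n n0) mfn (fun=> fM _)).
  exact: (kernel_variance_ge0 n (mu_moments n n0) (p_orthonormal n n0) mfn (fun=> fM _)).
(* By [kv_ge0] the variance is a nonnegative real for positive [n], so a one-sided real estimate
   implies the extended-real limit. *)
suff lim0 e : 0 < e -> \forall n \near \oo,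
    n%:R `^ (alpha - 1) *
      kernel_variance (mu n) (p n) n (fun x => f (n%:R `^ alpha * (x - xstar))) <= e.
  apply/fine_cvgP; split.
    near=> n; have [|V _ [-> _]] := kv_ge0 n; last by rewrite -EFinM.
    by near: n; exact: nbhs_infty_gt.
  apply/cvgrPdist_le => e /lim0 lime; near=> n.
  have [|V V0 [VE Vk]] := kv_ge0 n; first by near: n; exact: nbhs_infty_gt.
  rewrite /= VE /= sub0r normrN ger0_norm ?mulr_ge0 ?powR_ge0// Vk.
  by near: n.
move=> e0.
(* These are the coefficients of [eps] and [delta] once the fixed-size bound is multiplied by
   [T / n]. *)
pose c1 := 4 * M * C * a; pose c2 := 4 * M ^+ 2 * (size D)%:R * C.
have c1_ge0 : 0 <= c1 by rewrite !mulr_ge0.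
have c2_ge0 : 0 <= c2 by rewrite !mulr_ge0 ?sqr_ge0.
(* Each of the two terms is then at most [e / 2]; adding 1 keeps the divisors positive. *)
pose eps := e / (2 * (c1 + 1)); pose delta := e / (2 * (c2 + 1)).
have eps_gt0 : 0 < eps by rewrite divr_gt0// mulr_gt0// ltr_wpDl.
have delta_gt0 : 0 < delta by rewrite divr_gt0// mulr_gt0// ltr_wpDl.
have half (c : R) : 0 <= c -> c * (e / (2 * (c + 1))) <= e / 2.
  move=> c0; rewrite mulrA ler_pdivrMr ?mulr_gt0 ?ltr_wpDl//.
  by rewrite [leRHS](_ : _ = e * (c + 1)); [nra|field].
pose g x := f x * cutoff D delta x; pose h x := f x - g x.
have fcut x : `|g x| <= M.
  rewrite normrM -[leRHS]mulr1; apply: ler_pM => //.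
  by rewrite ger0_norm ?cutoff_ge0 ?cutoff_le1.
have hE x : h x = f x * (1 - cutoff D delta x) by rewrite /h /g; ring.
have hM x : `|h x| <= M.
  rewrite hE normrM -[leRHS]mulr1; apply: ler_pM => //.
  have := cutoff_ge0 D x delta_gt0; have := cutoff_le1 D x delta_gt0.
  by move=> ? ?; rewrite ger0_norm; lra.
have g_cont : continuous g.
  apply: (@continuous_mul_cutoff R f M) => // x xD.
  by have : [set x : R | ~ {for x, continuous f}] x by []; rewrite DE.
have mg : measurable_fun setT g by exact: continuous_measurable_fun.
have mh : measurable_fun setT h by exact: measurable_funB.
have ga x : g x != 0 -> `|x| <= a.
  by move=> gx; apply: fa; apply: contra_neq gx; rewrite /g => ->; rewrite mul0r.
have hD x : h x != 0 -> `|x| <= a /\ exists2 d, d \in D & `|x - d| <= delta.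
  rewrite hE mulf_eq0 negb_or subr_eq0 [1 == _]eq_sym => /andP[/fa xa cut].
  by split=> //; exact: cutoff_neq1 cut.
have /nbhs_ballP[r /= r0 rI] : nbhs xstar I by exact: xstar_in_I.
(* Since [delta] is fixed before [n], so is [g], and the Nevai condition applies to it on the
   compact set of rescaled points [[- a, a]]. *)
have osc_small := uniform_cvg0 eps_gt0
  (nevai g g_cont (compactly_supported_mul f_supp) _ (@segment_compact R (- a) a)).
(* Once [T] is at least [(a + 1) / r], the band of half-width [a / T] lies in the ball of radius [r]
   around [xstar], hence in [I]. *)
have T_large := near_powR_ge alpha_gt0 (divr_gt0 (ltr_wpDl a_ge0 ltr01) r0).
near=> n.
have n0 : (0 < n)%N by near: n; exact: nbhs_infty_gt.
have nR0 : 0 < n%:R :> R by rewrite ltr0n.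
set T := n%:R `^ alpha.
have T0 : 0 < T by rewrite powR_gt0.
have bandI : band T xstar 0 a `<=` I.
  move=> x; rewrite /band/= subr0 => xa; apply: rI.
  rewrite -ball_normE /= distrC -(ltr_pM2l T0).
  have -> : T * `|x - xstar| = `|T * (x - xstar)| by rewrite normrM (gtr0_norm T0).
  have : (a + 1) / r <= T by rewrite /T; near: n; exact: T_large.
  rewrite ler_pdivrMr//; apply: lt_le_trans.
  by rewrite (le_lt_trans xa)// ltrDl ltr01.
have osc x : band T xstar 0 a x ->
    `|kernel_oscillation (mu n) (p n) n (fun y => g (T * (y - xstar))) x| <= eps.
  rewrite /band/= subr0 => xa.
  (* The Nevai variable is [s = T * (x - xstar)], which lies in [[- a, a]] because [x] is in the
     band. *)
  have xE : xstar + T * (x - xstar) / T = x.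
    by rewrite mulrAC divff ?gt_eqF// mul1r addrC subrK.
  have osc_n : forall s, `[- a, a]%classic s ->
      `|\int[mu n]_y ((g s - g (n%:R `^ alpha * (y - xstar))) *
         (cd_kernel (p n) n (xstar + s / n%:R `^ alpha) y ^+ 2 /
          cd_kernel (p n) n (xstar + s / n%:R `^ alpha)
                            (xstar + s / n%:R `^ alpha)))| < eps.
    by near: n; exact: osc_small.
  have := osc_n (T * (x - xstar)); rewrite /= in_itv/= -ler_norml -/T xE.
  by move=> /(_ xa)/ltW.
have := kernel_variance_decomposition_le n0 (mu_moments n n0) (p_orthonormal n n0)
  (mu_decomp n n0) I_interval (musing_I n n0) (mulr_ge0 C_ge0 (ltW nR0))
  (fun t It => KC n t n0 It) T0 a_ge0 (ltW delta_gt0) (ltW eps_gt0) mg mh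
  (f := f) (fun x => esym (subrKC (g x) (f x))) fcut hM ga hD bandI osc.
have nT : n%:R `^ (alpha - 1) = T / n%:R.
  by rewrite powRB ?powRr1 ?(ltW nR0)//; apply/implyP => _; rewrite gt_eqF.
rewrite nT => bound.
apply: le_trans (ler_wpM2l _ bound) _; first by rewrite divr_ge0// ltW.
have T_neq0 : T != 0 by rewrite gt_eqF.
have n_neq0 : n%:R != 0 :> R by rewrite gt_eqF.
(* The factor [n] from the kernel bound and [1 / T] from the band lengths cancel against the
   prefactor. *)
have -> : T / n%:R * (2 * (M * eps * (C * n%:R * (2 * a / T))) +
    2 * (M ^+ 2 * ((size D)%:R * (C * n%:R * (2 * delta / T))))) =
    c1 * eps + c2 * delta.
  by rewrite /c1 /c2; field; rewrite T_neq0 n_neq0.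
by have := half _ c1_ge0; have := half _ c2_ge0; rewrite -/eps -/delta; lra.
Unshelve. all: by end_near. Qed.
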